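(* Let $q$ be an odd prime power, $\mathbb F_q$ the finite field of order $q$, $d$ a positive integer, and $A\subset \mathbb F_q^d$. Let $\mathcal{SQ}(A)$ and $\mathcal{ZR}(A)$ be the number of pairs $(x,y)\in A\times A$ such that $\eta(\|x-y\|)=1$ and the number of pairs with $\eta(\|x-y\|)=0$, respectively. Then: \begin{enumerate} \item If $d\equiv 3 \pmod 4$ and $q\equiv 3\pmod 4$, then $$\mathcal{SQ}(A)+\mathcal{ZR}(A) \le \frac{|A|^2}{2} +\frac{|A|^2}{2q} - \frac{|A|^2}{2 q^{\frac{d-1}{2}}} - \frac{|A|^2}{2 q^{\frac{d+1}{2}}}+ q^{\frac{d-1}{2}} |A|.$$ \item If $d\equiv 1 \pmod 4$, or $d\equiv 3 \pmod 4$ and $q\equiv 1\pmod 4$, then $$\mathcal{SQ}(A)+\mathcal{ZR}(A) \le \frac{|A|^2}{2} +\frac{|A|^2}{2q}+ \frac{q^{\frac{d+1}{2}} |A|}{2} -\frac{q^{\frac{d-1}{2}} |A|}{2}.$$ \item If $d\equiv 2 \pmod 4$ and $q\equiv 3\pmod 4$, then $$\mathcal{SQ}(A)+\mathcal{ZR}(A) \le \frac{|A|^2}{2} +\frac{|A|^2}{2q}-\frac{|A|^2}{q^{\frac{d}{2}}}+ \frac{q^{\frac{d}{2}} |A|}{2} +\frac{q^{\frac{d-2}{2}}|A|}{2}.$$ \item If $d\equiv 0 \pmod 4$, or $d\equiv 2 \pmod 4$ and $q\equiv 1\pmod 4$, then $$\mathcal{SQ}(A)+\mathcal{ZR}(A)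 \le \frac{|A|^2}{2} +\frac{|A|^2}{2q}+ \frac{q^{\frac{d}{2}} |A|}{2}-\frac{q^{\frac{d-2}{2}}|A|}{2}.$$ \end{enumerate}
   Context: For $x,y\in\mathbb F_q^d$, $\|x-y\|:=(x_1-y_1)^2+\cdots+(x_d-y_d)^2\in\mathbb F_q$. $\eta$ denotes the quadratic character of $\mathbb F_q$ (so $\eta(a)=1$ if $a$ is a nonzero square, $\eta(a)=-1$ if $a$ is a non-square) with the convention $\eta(0)=0$. *)

(* Defs.v *)
From HB Require Import structures.
From mathcomp Require Import all_boot all_order all_algebra all_field.
Set Implicit Arguments. Unset Strict Implicit. Unset Printing Implicit Defensive.
Import Order.TTheory GRing.Theory Num.Theory.
Local Open Scope ring_scope.

Definition sqdist (F : finFieldType) (d : nat) (x y : 'rV[F]_d) : F :=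
  \sum_(i < d) (x 0 i - y 0 i) ^+ 2.

Definition eta (F : finFieldType) (a : F) : int :=
  if a == 0 then 0
  else if [exists b : F, b ^+ 2 == a] then 1 else -1.

Definition SQ (F : finFieldType) (d : nat) (A : {set 'rV[F]_d}) : nat :=
  #|[set p in setX A A | eta (sqdist p.1 p.2) == 1]|.

Definition ZR (F : finFieldType) (d : nat) (A : {set 'rV[F]_d}) : nat :=
  #|[set p in setX A A | eta (sqdist p.1 p.2) == 0]|.

(* Main.v *)
(* Write [q^d f(z)] as a Fourier sum [\sum_m w(m) chi(m . z)] over F^d, where
   [f(z) = 1 + eta ||z|| + [||z|| = 0]] is twice the indicator of "||z|| is a
   square".  Then [2 q^d S = \sum_m w(m) |\hat A(m)|^2], and Parseval gives
   [2 q^d S <= w(0) |A|^2 + M (q^d |A| - |A|^2)] for any M bounding w off 0.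
   Completing the square and [g^2 = eta(-1) q] for the Gauss sum g show that
   [w(m)] is an explicit real function of ||m||; its maximum off 0 depends only
   on the parity of d and on the sign of [eta(-1)^(d./2)], which produces
   the four cases. *)
Require Import Defs.
From HB Require Import structures.
From mathcomp Require Import all_boot all_order all_algebra all_field.
From mathcomp Require Import all_fingroup all_solvable all_character ring lra zify.
Set Implicit Arguments. Unset Strict Implicit. Unset Printing Implicit Defensive.
(* Re-imported because [HB.structures] also exports a constant named [eta]. *)
Import Defs.
Import Order.TTheory GRing.Theory Num.Theory.
Local Open Scope ring_scope.

(** * Nontrivial additive characters of a finite field *)

Definition is_additive_char (F : finFieldType) (chi : F -> algC) :=
  [/\ {morph chi : x y / x + y >-> x * y}, forall x, `|chi x| = 1
    & exists x, chi x != 1].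

(** The kernels of the irreducible characters of the additive group intersect trivially, so one of
    them misses the field element 1. The group is abelian, hence that character is linear:
    multiplicative, with values of modulus 1. *)
Lemma exists_additive_char (F : finFieldType) :
  exists chi : F -> algC, is_additive_char chi.
Proof.
have abF : abelian [set: F] by apply/centsP => x _ y _; exact: addrC.
have : (1%R : F) \notin \bigcap_i cfker 'chi[[set: F]]_i.
  by rewrite TI_cfker_irr inE; exact: oner_neq0.
move/bigcapP => nker.
have [i iP] : exists i, (1%R : F) \notin cfker 'chi[[set: F]]_i.
  apply/existsP; apply: contraT => /existsPn all_ker.
  by case: nker => i _; exact/negPn/all_ker.
have lin : 'chi[[set: F]]_i \is a linear_char by exact: char_abelianP.
exists ('chi[[set: F]]_i); split.
- by move=> x y; rewrite -[x + y]/(x * y)%g lin_charM ?inE.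
- by move=> x; rewrite normC_lin_char ?inE.
- by exists 1; move: iP; rewrite cfkerEirr !inE /= lin_char1.
Qed.

(** * The quadratic character in odd order *)

Section QuadraticCharacter.
Variable F : finFieldType.
Hypothesis Fodd : odd #|F|.

Lemma card_gt1 : (1 < #|F|)%N. Proof. exact: finNzRing_gt1. Qed.

Lemma two_neq0 : (2%:R : F) != 0.
Proof.
apply/negP => /eqP two0.
have ch2 : 2%N \in [pchar F] by rewrite inE /= two0 eqxx.
have := card_pprimeChar ch2; move: Fodd card_gt1 => + + cardF.
rewrite [X in odd X]cardF [X in (1 < X)%N]cardF oddX orbF.
by move/eqP->.
Qed.

Lemma expf_predcard (x : F) : x != 0 -> x ^+ #|F|.-1 = 1.
Proof.
move=> x0; apply: (mulfI x0); rewrite mulr1 -exprS prednK ?expf_card //.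
exact: ltn_trans card_gt1.
Qed.

Lemma exists_primitive_root : exists g : F, (#|F|.-1).-primitive_root g.
Proof.
have := @has_prim_root F #|F|.-1 [seq x <- enum F | x != 0].
have sz : size [seq x <- enum F | x != 0] = #|F|.-1.
  by rewrite enumT -(cardC1 (0 : F)) cardE.
case/(_ _ _ _ _)/hasP.
- by rewrite -ltnS prednK ?finNzRing_gt1 // (ltn_trans _ card_gt1).
- apply/allP => x; rewrite mem_filter => /andP[x0 _].
  exact/unity_rootP/expf_predcard.
- by rewrite filter_uniq ?enum_uniq.
- by rewrite sz.
- by move=> g _ gP; exists g.
Qed.

(** Since [#|F|.-1] is even, the parity of an exponent of [g] is well defined, and the squares are
    the even powers. Multiplicativity and the value at -1 are read off from this discrete
    logarithm. *)
Lemma eta_expg (g : F) (i : nat) :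
  (#|F|.-1).-primitive_root g -> eta (g ^+ i) = (-1) ^+ i.
Proof.
move=> gP; have g0 : g != 0.
  apply/eqP=> g0; have := prim_expr_order gP.
  rewrite g0 expr0n; case: eqP => [q1|_ /eqP]; last by rewrite eq_sym oner_eq0.
  by move: card_gt1; lia.
rewrite /eta expf_eq0 (negPf g0) andbF.
have -> : [exists b : F, b ^+ 2 == g ^+ i] = ~~ odd i.
  apply/existsP/idP => [[b /eqP bP]|ev].
    have b0 : b != 0 by move: (expf_neq0 i g0); rewrite -bP expf_eq0.
    have [j bj] := prim_rootP gP (expf_predcard b0).
    move/eqP: bP; rewrite bj -exprM (eq_prim_root_expr gP) => /eqP.
    move=> /(congr1 odd); rewrite !odd_mod; first by rewrite oddM andbF => <-.
      by move: Fodd card_gt1; lia.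
    by move: Fodd card_gt1; lia.
  exists (g ^+ i./2); rewrite -exprM muln2 even_halfK //.
by case: ifPn => [/negPf|/negPn] io; rewrite -signr_odd io.
Qed.

Lemma eta0 : eta (0 : F) = 0. Proof. by rewrite /eta eqxx. Qed.

Lemma etaM (a b : F) : eta (a * b) = eta a * eta b.
Proof.
have [->|a0] := eqVneq a 0; first by rewrite mul0r eta0 mul0r.
have [->|b0] := eqVneq b 0; first by rewrite mulr0 eta0 mulr0.
have [g gP] := exists_primitive_root.
have [i ->] := prim_rootP gP (expf_predcard a0).
have [j ->] := prim_rootP gP (expf_predcard b0).
by rewrite -exprD !eta_expg // exprD.
Qed.

Lemma eta_sqr (a : F) : eta a ^+ 2 = (a != 0)%:R.
Proof. by rewrite /eta; case: (a == 0) => //; case: ifP. Qed.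

Lemma eta1 : eta (1 : F) = 1.
Proof. by have [g gP] := exists_primitive_root; rewrite -(expr0 g) eta_expg. Qed.

Lemma etaV (a : F) : eta a^-1 = eta a.
Proof.
have [->|a0] := eqVneq a 0; first by rewrite invr0.
(* The factor 1 is turned into [eta a ^+ 2], so that [eta a^-1 * eta a = eta 1] applies. *)
rewrite -[LHS]mulr1 -[X in _ * X]/(true%:R) -a0 -eta_sqr expr2 mulrA -etaM.
by rewrite mulVf // eta1 mul1r.
Qed.

(** The power of [g] with exponent [(#|F|.-1)./2] squares to 1 and is not 1, as [g] has order
    [#|F|.-1]; so it is -1. *)
Lemma eta_opp1 : eta (-1 : F) = (-1) ^+ (#|F|.-1)./2.
Proof.
have [g gP] := exists_primitive_root.
rewrite -(eta_expg _ gP); congr eta; apply/eqP; rewrite eq_sym.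
have : (g ^+ (#|F|.-1)./2) ^+ 2 == 1.
  rewrite -exprM muln2 even_halfK ?(prim_expr_order gP) //.
  by move: Fodd card_gt1; lia.
rewrite sqrf_eq1 => /orP[|//].
rewrite -(prim_order_dvd gP) => /dvdn_leq; move: Fodd card_gt1; lia.
Qed.

Lemma card_sqrt (t : F) : #|[pred u : F | u ^+ 2 == t]|%:R = 1 + eta t.
Proof.
rewrite /eta; have [->|t0] := eqVneq t 0.
  by rewrite (eq_card (B := pred1 0)) ?card1 // => u; rewrite !inE expf_eq0.
case: existsP => [[b /eqP bt]|nsq].
  rewrite (eq_card (B := pred2 b (- b))) ?card2; last first.
    by move=> u; rewrite !inE -bt eqf_sqr.
  suff -> : b != - b by [].
  rewrite -addr_eq0 -(mulr2n b) -mulr_natr mulf_neq0 ?two_neq0 //.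
  by move: t0; rewrite -bt expf_eq0.
rewrite (eq_card (B := pred0)) ?card0 //.
by move=> u; rewrite !inE; apply/negP => ut; apply: nsq; exists u.
Qed.

(** Grouping the [u] by their square turns a quadratic sum into a linear one, weighted by the number
    of square roots of [t]. *)
Lemma sum_sqr (R : pzRingType) (h : F -> R) :
  \sum_u h (u ^+ 2) = \sum_t (1 + (eta t)%:~R) * h t.
Proof.
rewrite (partition_big (fun u => u ^+ 2) predT) //=; apply: eq_bigr => t _.
rewrite (eq_bigr (fun=> h t)) => [|u /eqP-> //].
rewrite sumr_const -mulr_natl; congr (_ * _).
by rewrite -[1 in RHS](rmorph1 intr) -rmorphD /= -card_sqrt rmorph_nat.
Qed.

(** Taking [h = 1] in [sum_sqr] gives q on the left and q plus the sum on the right. *)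
Lemma sum_eta : \sum_(t : F) eta t = 0.
Proof.
have := sum_sqr (R := int) (fun=> 1); rewrite sumr_const.
under [X in _ = X]eq_bigr do rewrite mulr1 intz.
by rewrite big_split sumr_const /= -[LHS]addr0 => /addrI.
Qed.

End QuadraticCharacter.

(** * Quadratic Gauss sums *)

Section GaussSum.
Variables (F : finFieldType) (chi : F -> algC).
Hypotheses (Fodd : odd #|F|) (chiP : is_additive_char chi).

Let q : algC := #|F|%:R.
Let etaC (t : F) : algC := (eta t)%:~R.

Lemma chiD : {morph chi : x y / x + y >-> x * y}.
Proof. by case: chiP. Qed.

Lemma chi_neq0 x : chi x != 0.
Proof. by case: chiP => _ n1 _; rewrite -normr_eq0 n1 oner_neq0. Qed.

Lemma chi0 : chi 0 = 1.
Proof. by apply: (mulfI (chi_neq0 0)); rewrite -chiD addr0 mulr1. Qed.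

Lemma chiN x : chi (- x) = (chi x)^*.
Proof.
apply: (mulfI (chi_neq0 x)); rewrite -chiD subrr chi0 -normCK.
by case: chiP => _ -> _; rewrite expr1n.
Qed.

Lemma chi_sum (I : finType) (f : I -> F) : chi (\sum_i f i) = \prod_i chi (f i).
Proof. exact: (big_morph _ chiD chi0). Qed.

(** Translating [t] by [t0 / s] multiplies the sum by [chi t0], which differs from 1; so the sum
    vanishes for [s != 0]. *)
Lemma sum_chi (s : F) : \sum_t chi (t * s) = q * (s == 0)%:R.
Proof.
have [->|s0] := eqVneq s 0.
  rewrite (eq_bigr (fun=> 1)) => [|t _]; last by rewrite mulr0 chi0.
  by rewrite sumr_const mulr1.
have [_ _ [t0 t0P]] := chiP; rewrite mulr0; apply/eqP.
have : (1 - chi t0) * \sum_t chi (t * s) == 0.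
  rewrite mulrBl mul1r mulr_sumr subr_eq0.
  rewrite [X in X == _](reindex (fun t => t + t0 / s)) /=; last first.
    by exists (fun t => t - t0 / s) => t _; rewrite ?addrK ?subrK.
  by apply/eqP/eq_bigr => t _; rewrite mulrDl divfK // -chiD addrC.
by rewrite mulf_eq0 subr_eq0 eq_sym (negPf t0P).
Qed.

Definition gauss_sum : algC := \sum_t etaC t * chi t.

Lemma etaCM (a b : F) : etaC (a * b) = etaC a * etaC b.
Proof. by rewrite /etaC etaM // rmorphM. Qed.

Lemma etaC_sqr (a : F) : etaC a ^+ 2 = (a != 0)%:R.
Proof. by rewrite /etaC -rmorphXn eta_sqr /=; case: (a != 0). Qed.

Lemma etaC0 : etaC 0 = 0. Proof. by rewrite /etaC eta0. Qed.

Lemma sum_eta_chi (s : F) : \sum_t etaC t * chi (t * s) = etaC s * gauss_sum.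
Proof.
have [->|s0] := eqVneq s 0.
  rewrite etaC0 mul0r (eq_bigr etaC) => [|t _]; last by rewrite mulr0 chi0 mulr1.
  by rewrite -rmorph_sum sum_eta.
rewrite /gauss_sum mulr_sumr [RHS](reindex (fun t => t * s)) /=; last first.
  by exists (fun t => t / s) => t _; rewrite ?mulfK ?divfK.
apply: eq_bigr => t _; rewrite mulrA etaCM; congr (_ * _).
by rewrite mulrCA -expr2 etaC_sqr s0 mulr1.
Qed.

(** The sum over [s] of the products of the twisted Gauss sums at [s] and [- s] is computed twice:
    by pulling out [eta], and by expanding and using orthogonality. Comparing the two and cancelling
    [q - 1] gives the value. *)
Lemma gauss_sum_sqr : gauss_sum ^+ 2 = etaC (-1) * q.
Proof.
have e1 : etaC (-1) ^+ 2 = 1 by rewrite etaC_sqr oppr_eq0 oner_eq0.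
have sum_sq : \sum_t etaC t ^+ 2 = q - 1.
  rewrite (bigD1 0) //= etaC0 expr0n add0r.
  rewrite (eq_bigr (fun=> 1)) => [|t t0]; last by rewrite etaC_sqr t0.
  by rewrite sumr_const /q -(natrB _ (ltnW (card_gt1 F))) cardC1 subn1.
have q1 : q - 1 != 0.
  by rewrite subr_eq0 pnatr_eq1; move: (card_gt1 F); case: eqP => // ->.
apply: (mulfI q1).
transitivity (etaC (-1) * \sum_s (etaC s * gauss_sum) * (etaC (- s) * gauss_sum)).
  rewrite -sum_sq mulr_sumr mulr_suml; apply: eq_bigr => s _.
  rewrite -(mulN1r s) etaCM.
  transitivity (etaC (-1) ^+ 2 * (etaC s ^+ 2 * gauss_sum ^+ 2)).
    by rewrite e1 mul1r.
  by rewrite !expr2 !mulrA; ring.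
rewrite mulrCA; congr (_ * _).
under eq_bigr do rewrite -!sum_eta_chi mulr_suml.
rewrite exchange_big /= -sum_sq mulr_suml; apply: eq_bigr => t _.
under eq_bigr do rewrite mulr_sumr.
have orth u : \sum_s etaC t * chi (t * s) * (etaC u * chi (u * - s)) =
    etaC t * etaC u * (q * (t - u == 0)%:R).
  rewrite -sum_chi mulr_sumr; apply: eq_bigr => s _.
  by rewrite mulrACA -chiD; congr (_ * chi _); ring.
rewrite exchange_big /= (bigD1 t) //= [X in _ + X]big1 ?addr0 => [|u ut].
  by rewrite orth subrr eqxx mulr1 expr2.
by rewrite orth subr_eq0 eq_sym (negPf ut) !mulr0.
Qed.

Lemma gauss_sum_neq0 : gauss_sum != 0.
Proof.
rewrite -sqrf_eq0 gauss_sum_sqr -sqrf_eq0 exprMn etaC_sqr oppr_eq0 oner_eq0.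
by rewrite mul1r sqrf_eq0 pnatr_eq0 -lt0n ltnW ?card_gt1.
Qed.

(** Completing the square by the shift [z / (2 * s)] leaves a pure quadratic sum. In [sum_sqr] its
    unweighted half vanishes because [s != 0], and the [eta] half is a twisted Gauss sum. *)
Lemma sum_chi_quadratic (s z : F) : s != 0 ->
  \sum_u chi (s * u ^+ 2 + u * z) =
  etaC s * gauss_sum * chi (- (4%:R * s)^-1 * z ^+ 2).
Proof.
move=> s0; have t0 := two_neq0 Fodd.
have s2 : 2 * s != 0 by rewrite mulf_neq0.
rewrite (reindex (fun u => u - z / (2 * s))) /=; last first.
  by exists (fun u => u + z / (2 * s)) => u _; rewrite ?addrK ?subrK.
transitivity (\sum_u chi (u ^+ 2 * s) * chi (- (4%:R * s)^-1 * z ^+ 2)).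
  apply: eq_bigr => u _; rewrite -chiD; congr chi.
  have t4 : (4%:R : F) != 0 by rewrite (natrM _ 2 2) mulf_neq0.
  by field; rewrite s0 t0 t4.
transitivity ((\sum_u chi (u ^+ 2 * s)) * chi (- (4%:R * s)^-1 * z ^+ 2)).
  by rewrite mulr_suml.
rewrite (sum_sqr Fodd (fun t => chi (t * s))); congr (_ * _).
under eq_bigr do rewrite mulrDl mul1r.
by rewrite big_split /= sum_chi (negPf s0) mulr0 add0r sum_eta_chi.
Qed.

End GaussSum.

(** * Fourier transforms on [F^d] of functions of the norm *)

Definition sqnorm (F : finFieldType) (d : nat) (x : 'rV[F]_d) : F :=
  \sum_(i < d) x 0 i ^+ 2.

Definition dot (F : finFieldType) (d : nat) (x y : 'rV[F]_d) : F :=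
  \sum_(i < d) x 0 i * y 0 i.

(** Distributivity of product over sum; it lets exponential sums over [F^d] factor into one-variable
    sums. *)
Lemma sum_rV_prod (R : comPzRingType) (F : finFieldType) (d : nat) (h : 'I_d -> F -> R) :
  \sum_(m : 'rV[F]_d) \prod_i h i (m 0 i) = \prod_i \sum_u h i u.
Proof.
rewrite bigA_distr_bigA /=.
rewrite (reindex (fun f : {ffun 'I_d -> F} => \row_i f i)) /=.
  by apply: eq_bigr => f _; apply: eq_bigr => i _; rewrite mxE.
exists (fun m : 'rV[F]_d => [ffun i => m 0 i]) => m _.
  by apply/ffunP => i; rewrite ffunE mxE.
by apply/rowP => i; rewrite mxE ffunE.
Qed.

Section QuadricTransform.
Variables (F : finFieldType) (chi : F -> algC) (d : nat).
Hypotheses (Fodd : odd #|F|) (chiP : is_additive_char chi).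

Let q : algC := #|F|%:R.
Let etaC (t : F) : algC := (eta t)%:~R.
Let G := gauss_sum chi.

Lemma sum_chi_dot (z : 'rV[F]_d) :
  \sum_m chi (dot m z) = q ^+ d * (z == 0)%:R.
Proof.
under eq_bigr do rewrite /dot (chi_sum chiP).
rewrite (sum_rV_prod (fun i u => chi (u * z 0 i))).
under eq_bigr do rewrite (sum_chi chiP).
rewrite big_split /= prodr_const card_ord; congr (_ * _).
have [->|z0] := eqVneq z 0; first by rewrite big1 // => i _; rewrite mxE eqxx.
have [i zi] : exists i, z 0 i != 0.
  apply/existsP; apply: contraT => /existsPn z_eq0; case/eqP: z0.
  by apply/rowP => i; rewrite mxE; apply/eqP/negPn/z_eq0.
by rewrite (bigD1 i) //= (negPf zi) mul0r.
Qed.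

Lemma sum_chi_sqnorm (s : F) (z : 'rV[F]_d) : s != 0 ->
  \sum_m chi (s * sqnorm m + dot m z) =
  (etaC s * G) ^+ d * chi (- (4%:R * s)^-1 * sqnorm z).
Proof.
move=> s0.
transitivity (\sum_(m : 'rV[F]_d)
    \prod_i chi (s * m 0 i ^+ 2 + m 0 i * z 0 i)).
  apply: eq_bigr => m _; rewrite -(chi_sum chiP); congr chi.
  by rewrite /sqnorm /dot mulr_sumr -big_split.
rewrite (sum_rV_prod (fun i u => chi (s * u ^+ 2 + u * z 0 i))).
under eq_bigr do rewrite (sum_chi_quadratic Fodd chiP _ s0).
by rewrite big_split /= prodr_const card_ord -(chi_sum chiP) -mulr_sumr.
Qed.

(** On nonzero [s] the power depends only on the parity of [e]. Odd [e] gives a twisted Gauss sum;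
    even [e] gives the orthogonality sum minus its term at 0. This is where the parity of the
    dimension enters. *)
Lemma sum_eta_exp_chi (e : nat) (n : F) :
  \sum_(s | s != 0) etaC s ^+ e * chi (s * n) =
  if odd e then etaC n * G else q * (n == 0)%:R - 1.
Proof.
have exp_eta (s : F) : s != 0 -> etaC s ^+ e = etaC s ^+ odd e.
  move=> s0; rewrite -[e in LHS]odd_double_half exprD -mul2n exprM.
  by rewrite /etaC (etaC_sqr s) s0 expr1n mulr1.
case: ifP => eo; rewrite ?eo in exp_eta.
  rewrite /G -(sum_eta_chi Fodd chiP) [RHS](bigD1 0) //= eta0 mul0r add0r.
  by apply: eq_bigr => s s0; rewrite exp_eta.
rewrite -(sum_chi chiP) [X in _ = X - _](bigD1 0) //= mul0r (chi0 chiP).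
rewrite addrAC subrr add0r.
by apply: eq_bigr => s s0; rewrite exp_eta ?expr0 ?mul1r.
Qed.

(* The inner sum over [s] is inverted by the substitution [s = - (4 t)^-1]. *)
Lemma sum_quadric_transform (e : nat) (z : 'rV[F]_d) :
  \sum_s etaC s ^+ e * (\sum_m chi (s * sqnorm m + dot m z)) =
  (e == 0%N)%:R * (q ^+ d * (z == 0)%:R) + etaC (-1) ^+ (d + e) * G ^+ d *
    (if odd (d + e) then etaC (sqnorm z) * G
     else q * (sqnorm z == 0)%:R - 1).
Proof.
(* At [s = 0] the factor is [0 ^+ e], which is 1 for [e = 0] and 0 otherwise. *)
rewrite (bigD1 0) //=; congr (_ + _).
  rewrite /etaC eta0 expr0n; congr (_ * _); rewrite -sum_chi_dot.
  by apply: eq_bigr => m _; rewrite mul0r add0r.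
rewrite -sum_eta_exp_chi mulr_sumr.
have t4 : (4%:R : F) != 0 by rewrite (natrM _ 2 2) mulf_neq0 ?two_neq0.
have invK (s : F) : - (4%:R * - (4%:R * s)^-1)^-1 = s.
  by rewrite mulrN !invrN opprK !invfM invrK mulrA mulVf // mul1r invrK.
rewrite (reindex (fun s => - (4%:R * s)^-1)) /=; last first.
  by exists (fun s => - (4%:R * s)^-1) => s _; rewrite invK.
apply: eq_big => [s|s]; first by rewrite oppr_eq0 invr_eq0 mulf_eq0 (negPf t4).
move=> s0; rewrite sum_chi_sqnorm // invK exprMn.
(* The 4 drops out because it is a nonzero square, and inversion does not change [eta]. *)
have -> : etaC (- (4%:R * s)^-1) = etaC (-1) * etaC s.
  have eta4 : eta (4%:R : F) = 1.
    by rewrite (natrM _ 2 2) etaM // -expr2 eta_sqr two_neq0.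
  by rewrite -[X in etaC X]mulN1r /etaC etaM // etaV // etaM // eta4 mul1r rmorphM.
by rewrite !exprD !exprMn; ring.
Qed.

(** Case [e = 0]: summing [chi (s * sqnorm m)] over all [s] detects [sqnorm m == 0], with a factor
    q. *)
Lemma isotropic_transform (z : 'rV[F]_d) :
  q * (\sum_m (sqnorm m == 0)%:R * chi (dot m z)) =
  q ^+ d * (z == 0)%:R + etaC (-1) ^+ d * G ^+ d *
    (if odd d then etaC (sqnorm z) * G
     else q * (sqnorm z == 0)%:R - 1).
Proof.
have := sum_quadric_transform 0 z; rewrite mul1r addn0 => <-.
under [RHS]eq_bigr do rewrite expr0 mul1r.
rewrite exchange_big mulr_sumr /=; apply: eq_bigr => m _.
rewrite mulrA -(sum_chi chiP) mulr_suml.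
by apply: eq_bigr => s _; rewrite (chiD chiP).
Qed.

(** Case [e = 1]: summing [eta s * chi (s * sqnorm m)] over [s] produces [eta (sqnorm m)], with a
    factor [G]. *)
Lemma eta_transform (z : 'rV[F]_d) :
  G * (\sum_m etaC (sqnorm m) * chi (dot m z)) =
  etaC (-1) ^+ d.+1 * G ^+ d *
    (if odd d then q * (sqnorm z == 0)%:R - 1
     else etaC (sqnorm z) * G).
Proof.
have := sum_quadric_transform 1 z; rewrite mul0r add0r addn1 /= if_neg => <-.
under [RHS]eq_bigr do rewrite mulr_sumr.
rewrite exchange_big mulr_sumr /=; apply: eq_bigr => m _.
rewrite mulrA [G * _]mulrC -(sum_eta_chi Fodd chiP) mulr_suml.
by apply: eq_bigr => s _; rewrite (chiD chiP) expr1 mulrA.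
Qed.

End QuadricTransform.

(** * Parseval's identity and the spectral bound *)

Section SpectralBound.
Variables (F : finFieldType) (chi : F -> algC) (d : nat).
Hypothesis chiP : is_additive_char chi.

Lemma dotBr (m x y : 'rV[F]_d) : dot m (x - y) = dot m x - dot m y.
Proof. by rewrite /dot -sumrB; apply: eq_bigr => i _; rewrite !mxE mulrBr. Qed.

Lemma norm_transform (A : {set 'rV[F]_d}) (m : 'rV[F]_d) :
  `|\sum_(x in A) chi (dot m x)| ^+ 2 =
  \sum_(x in A) \sum_(y in A) chi (dot m (x - y)).
Proof.
rewrite normCK rmorph_sum mulr_suml; apply: eq_bigr => x _.
rewrite mulr_sumr; apply: eq_bigr => y _.
by rewrite dotBr (chiD chiP) (chiN chiP).
Qed.

Lemma parseval (A : {set 'rV[F]_d}) :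
  \sum_m `|\sum_(x in A) chi (dot m x)| ^+ 2 = #|F|%:R ^+ d * #|A|%:R.
Proof.
under eq_bigr do rewrite norm_transform.
rewrite exchange_big /= -[#|A|%:R]sumr_const mulr_sumr; apply: eq_bigr => x xA.
rewrite exchange_big /= (bigD1 x) //= [X in _ + X]big1 => [|y /andP[_ yx]].
  by rewrite (sum_chi_dot chiP) subrr eqxx addr0.
by rewrite (sum_chi_dot chiP) subr_eq0 eq_sym (negPf yx) mulr0.
Qed.

(** [w] and [f] are rational so that they are totally ordered; [ratr] carries the inequality into
    [algC], where the characters live. *)
Lemma spectral_bound (A : {set 'rV[F]_d}) (w f : 'rV[F]_d -> rat) (M : rat) :
  (forall z, \sum_m ratr (w m) * chi (dot m z) = #|F|%:R ^+ d * ratr (f z)) ->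
  (forall m, m != 0 -> w m <= M) ->
  #|F|%:R ^+ d * (\sum_(x in A) \sum_(y in A) f (x - y)) <=
  w 0 * #|A|%:R ^+ 2 + M * (#|F|%:R ^+ d * #|A|%:R - #|A|%:R ^+ 2).
Proof.
move=> wf wM.
pose E m : algC := `|\sum_(x in A) chi (dot m x)| ^+ 2.
have E0 : E 0 = #|A|%:R ^+ 2.
  rewrite /E (eq_bigr (fun=> 1)) ?sumr_const ?normr_nat // => x _.
  by rewrite /dot big1 ?(chi0 chiP) // => i _; rewrite mxE mul0r.
(* Regrouped so that [M] multiplies the whole Parseval sum; the excess [w 0 - M] stays on the zero
   frequency. *)
have -> : w 0 * #|A|%:R ^+ 2 + M * (#|F|%:R ^+ d * #|A|%:R - #|A|%:R ^+ 2) =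
    (w 0 - M) * #|A|%:R ^+ 2 + M * (#|F|%:R ^+ d * #|A|%:R) by ring.
rewrite -(ler_rat algC) rmorphD !rmorphM /= rmorphB !rmorphXn /= !rmorph_nat.
rewrite -expr2 -E0 -parseval rmorph_sum mulr_sumr /=.
have -> : \sum_(x in A) #|F|%:R ^+ d * ratr (\sum_(y in A) f (x - y)) =
    \sum_m ratr (w m) * E m.
  rewrite /E; under [RHS]eq_bigr do rewrite norm_transform mulr_sumr.
  rewrite exchange_big /=; apply: eq_bigr => x _.
  under [RHS]eq_bigr do rewrite mulr_sumr.
  rewrite exchange_big rmorph_sum mulr_sumr /=; apply: eq_bigr => y _.
  exact: esym (wf _).
rewrite mulr_sumr (bigD1 0) //= [X in _ <= _ + X](bigD1 0) //= addrA.
rewrite mulrBl subrK lerD2l; apply: ler_sum => m m0.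
by rewrite ler_wpM2r ?exprn_ge0 // ler_rat wM.
Qed.

End SpectralBound.

(** * Fourier inversion for the explicit weights *)

Section Weights.
Variables (F : finFieldType) (chi : F -> algC) (d : nat).
Hypotheses (Fodd : odd #|F|) (chiP : is_additive_char chi).

Let q : rat := #|F|%:R.
Let etaQ (t : F) : rat := (eta t)%:~R.

Definition twice_square_indicator (z : 'rV[F]_d) : rat :=
  1 + etaQ (sqnorm z) + (sqnorm z == 0)%:R.

(* The weights are the Fourier transforms of [twice_square_indicator], as they
   come out of [isotropic_transform] and [eta_transform]; [eta (-1) * q] is the
   square of the Gauss sum. *)
Definition odd_weight (m : 'rV[F]_d) : rat :=
  (m == 0)%:R * (q ^+ d + q ^+ d.-1) +
  (etaQ (-1) * q) ^+ d./2 *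
    (etaQ (sqnorm m) + q * (sqnorm m == 0)%:R - 1).

Definition even_weight (m : 'rV[F]_d) : rat :=
  (m == 0)%:R * (q ^+ d + q ^+ d.-1) +
  (etaQ (-1) * q) ^+ d./2 *
    (etaQ (-1) * etaQ (sqnorm m) + (sqnorm m == 0)%:R - q^-1).

Let Q : algC := #|F|%:R.
Let etaC (t : F) : algC := (eta t)%:~R.
Let G := gauss_sum chi.

Lemma ratr_etaQ (t : F) : ratr (etaQ t) = etaC t.
Proof. by rewrite /etaQ ratr_int. Qed.

Lemma ratr_bool (b : bool) : ratr b%:R = b%:R :> algC.
Proof. exact: ratr_nat. Qed.

Lemma Q_neq0 : Q != 0.
Proof. by rewrite pnatr_eq0 -lt0n ltnW ?card_gt1. Qed.

Lemma etaC_opp1_sqr : etaC (-1) ^+ 2 = 1.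
Proof. by rewrite /etaC etaC_sqr oppr_eq0 oner_eq0. Qed.

(** Squaring removes the sign. The result is [Q ^+ d.-1] for odd [d] and [Q ^+ d] for even [d],
    which supplies the factor [#|F| ^+ d] in the inversion. *)
Lemma half_power_sqr : ((etaC (-1) * Q) ^+ d./2) ^+ 2 = Q ^+ (d./2).*2.
Proof.
by rewrite -exprM exprMn mulnC exprM etaC_opp1_sqr expr1n mul1r mul2n.
Qed.

Lemma sum_delta (R : pzSemiRingType) (T : finType) (x : T) (h : T -> R) :
  \sum_y (y == x)%:R * h y = h x.
Proof.
rewrite (bigD1 x) //= eqxx mul1r big1 ?addr0 // => y yx.
by rewrite (negPf yx) mul0r.
Qed.

(** Inversion is checked by applying the two transforms again. In odd dimension they exchange [eta]
    and the indicator of norm 0, up to multiples of delta at 0 and constants. *)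
Lemma odd_weight_transform (z : 'rV[F]_d) : odd d ->
  \sum_m ratr (odd_weight m) * chi (dot m z) =
  #|F|%:R ^+ d * ratr (twice_square_indicator z) :> algC.
Proof.
move=> d_odd; set k := d./2.
have dk : d = (k.*2.+1)%N by rewrite -[LHS]odd_double_half d_odd.
have e1 := etaC_opp1_sqr; have Psq := half_power_sqr.
have G2 : G ^+ 2 = etaC (-1) * Q by exact: gauss_sum_sqr.
have Z := isotropic_transform Fodd chiP z.
have N := eta_transform Fodd chiP z.
rewrite d_odd in Z N; move: Z N; rewrite -/Q -/G -/k in Psq *.
rewrite -![(eta _)%:~R]/(etaC _).
set SZ := \sum_m _; set SN := \sum_m _; set P := (etaC (-1) * Q) ^+ k in Psq *.
(* As [d = 2k + 1], the extra [G] completes one more square [G ^+ 2]; its [eta (-1)] cancels the odd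
   one left from [etaC (-1) ^+ d]. *)
have -> : etaC (-1) ^+ d * G ^+ d * (etaC (sqnorm z) * G) =
    P * Q * etaC (sqnorm z).
  transitivity ((etaC (-1) ^+ 2) ^+ k * (G ^+ 2) ^+ k *
      (etaC (-1) * G ^+ 2 * etaC (sqnorm z))).
    by rewrite -!exprM !mul2n {1 2}dk !exprS; ring.
  rewrite G2 -/P e1 expr1n.
  transitivity (etaC (-1) ^+ 2 * (P * Q * etaC (sqnorm z))); first by ring.
  by rewrite e1 mul1r.
have -> : etaC (-1) ^+ d.+1 * G ^+ d * (Q * (sqnorm z == 0)%:R - 1) =
    G * (P * (Q * (sqnorm z == 0)%:R - 1)).
  transitivity ((etaC (-1) ^+ 2) ^+ k.+1 * (G ^+ 2) ^+ k * G *
      (Q * (sqnorm z == 0)%:R - 1)).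
    by rewrite -!exprM !mul2n {1 2}dk doubleS !exprS; ring.
  by rewrite G2 -/P e1 expr1n; ring.
(* The single unpaired Gauss sum stands on both sides and is nonzero. *)
move=> Z /(mulfI (gauss_sum_neq0 Fodd chiP)) N.
transitivity ((Q ^+ d + Q ^+ d.-1) + P * (SN + Q * SZ - Q ^+ d * (z == 0)%:R)).
  rewrite (eq_bigr (fun m => (m == 0)%:R * (Q ^+ d + Q ^+ d.-1) +
      P * (etaC (sqnorm m) * chi (dot m z) +
        Q * ((sqnorm m == 0)%:R * chi (dot m z)) - chi (dot m z)))).
    rewrite big_split /= sum_delta -mulr_sumr sumrB big_split /= -mulr_sumr.
    by rewrite (sum_chi_dot chiP).
  move=> m _.
  rewrite /odd_weight !(rmorphN, rmorphD, rmorphM, rmorphXn, rmorph1) /=.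
  rewrite !ratr_etaQ !ratr_bool !ratr_nat -/Q -/P.
  (* The delta term carries no character, as [chi (dot 0 z) = 1]. *)
  have [->|_] := eqVneq m 0; rewrite /= ?mulr0n ?mulr1n; last by ring.
  rewrite /dot [X in chi X]big1 ?(chi0 chiP) => [|i _]; first by ring.
  by rewrite mxE mul0r.
rewrite Z N /twice_square_indicator !(rmorphD, rmorph1) /= ratr_etaQ ratr_bool.
have Qd1 : Q ^+ d.-1 = P ^+ 2 by rewrite Psq [in LHS]dk.
have Qd : Q ^+ d = Q * P ^+ 2 by rewrite Psq [in LHS]dk exprS.
by rewrite -/Q Qd Qd1; ring.
Qed.

(** In even dimension each transform preserves its kind: [eta] returns [eta], and the indicator of
    norm 0 returns itself, up to delta and constant terms. The two factors [eta (-1)] met by [eta]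
    square to 1. *)
Lemma even_weight_transform (z : 'rV[F]_d) : (0 < d)%N -> ~~ odd d ->
  \sum_m ratr (even_weight m) * chi (dot m z) =
  #|F|%:R ^+ d * ratr (twice_square_indicator z) :> algC.
Proof.
move=> d_gt0 d_even; set k := d./2.
have dk : d = k.*2 by rewrite -[LHS]odd_double_half (negPf d_even).
have e1 := etaC_opp1_sqr; have Psq := half_power_sqr.
have G2 : G ^+ 2 = etaC (-1) * Q by exact: gauss_sum_sqr.
have Z := isotropic_transform Fodd chiP z.
have N := eta_transform Fodd chiP z.
rewrite (negPf d_even) in Z N; move: Z N; rewrite -/Q -/G -/k in Psq *.
rewrite -![(eta _)%:~R]/(etaC _).
set SZ := \sum_m _; set SN := \sum_m _; set P := (etaC (-1) * Q) ^+ k in Psq *.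
have -> : etaC (-1) ^+ d * G ^+ d * (Q * (sqnorm z == 0)%:R - 1) =
    P * (Q * (sqnorm z == 0)%:R - 1).
  by rewrite {1 2}dk -!mul2n !exprM e1 expr1n mul1r G2.
have -> : etaC (-1) ^+ d.+1 * G ^+ d * (etaC (sqnorm z) * G) =
    G * (P * etaC (-1) * etaC (sqnorm z)).
  by rewrite {1 2}dk -!mul2n exprS !exprM e1 expr1n mulr1 G2 -/P; ring.
move=> Z /(mulfI (gauss_sum_neq0 Fodd chiP)) N.
transitivity ((Q ^+ d + Q ^+ d.-1) +
    P * (etaC (-1) * SN + SZ - Q^-1 * (Q ^+ d * (z == 0)%:R))).
  rewrite (eq_bigr (fun m => (m == 0)%:R * (Q ^+ d + Q ^+ d.-1) +
      P * (etaC (-1) * (etaC (sqnorm m) * chi (dot m z)) +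
        (sqnorm m == 0)%:R * chi (dot m z) - Q^-1 * chi (dot m z)))).
    rewrite big_split /= sum_delta -mulr_sumr sumrB big_split /= -!mulr_sumr.
    by rewrite (sum_chi_dot chiP).
  move=> m _.
  rewrite /even_weight !(rmorphN, rmorphD, rmorphM, rmorphXn, rmorph1, fmorphV) /=.
  rewrite !ratr_etaQ !ratr_bool !ratr_nat -/Q -/P.
  have [->|_] := eqVneq m 0; rewrite /= ?mulr0n ?mulr1n; last by ring.
  rewrite /dot [X in chi X]big1 ?(chi0 chiP) => [|i _]; first by ring.
  by rewrite mxE mul0r.
have Q0 := Q_neq0.
have -> : SZ = Q^-1 * (Q * SZ) by rewrite mulKf.
have -> : Q ^+ d.-1 = Q ^+ d / Q by rewrite -[in RHS](prednK d_gt0) exprSr mulfK.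
rewrite Z N /twice_square_indicator !(rmorphD, rmorph1) /= ratr_etaQ ratr_bool.
rewrite -/Q.
have -> : Q ^+ d = P ^+ 2 by rewrite Psq [in LHS]dk.
have -> : P * (etaC (-1) * (P * etaC (-1) * etaC (sqnorm z)) +
   Q^-1 * (P ^+ 2 * (z == 0)%:R + P * (Q * (sqnorm z == 0)%:R - 1)) -
   Q^-1 * (P ^+ 2 * (z == 0)%:R)) =
   P ^+ 2 * (etaC (-1) ^+ 2 * etaC (sqnorm z) +
     Q^-1 * (Q * (sqnorm z == 0)%:R - 1)) by ring.
by rewrite e1; field.
Qed.

End Weights.

(** * Counting pairs at square distance *)

Section Energy.
Variables (F : finFieldType) (d : nat) (A : {set 'rV[F]_d}).
Hypothesis Fodd : odd #|F|.

Let q : rat := #|F|%:R.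
Let a : rat := #|A|%:R.
Let S : rat := (SQ A + ZR A)%:R.
Let etaQ (t : F) : rat := (eta t)%:~R.
Let P : rat := (etaQ (-1) * q) ^+ d./2.

Lemma card_setX_filter (p : pred ('rV[F]_d * 'rV[F]_d)) :
  #|[set u in setX A A | p u]|%:R = \sum_(x in A) \sum_(y in A) (p (x, y))%:R :> rat.
Proof.
rewrite -sum1_card natr_sum pair_big /= big_mkcond [RHS]big_mkcond /=.
by apply: eq_bigr => -[x y] _; rewrite !inE /=;
  case: (x \in A); case: (y \in A); case: (p _).
Qed.

Lemma sum_twice_square_indicator :
  \sum_(x in A) \sum_(y in A) twice_square_indicator (x - y) = 2 * S.
Proof.
rewrite /S natrD !card_setX_filter -big_split mulr_sumr; apply: eq_bigr => x _.
rewrite -big_split mulr_sumr; apply: eq_bigr => y _ /=.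
have -> : sqdist x y = sqnorm (x - y).
  by apply: eq_bigr => i _; rewrite !mxE.
rewrite /twice_square_indicator /eta.
by case: (_ == 0); last (case: ifP => _); rewrite /=; ring.
Qed.

Lemma sqnorm0 : sqnorm (0 : 'rV[F]_d) = 0.
Proof. by rewrite /sqnorm big1 // => i _; rewrite mxE expr0n. Qed.

(** Off 0 the weight depends on [m] only through its norm, so [M] is tested on field elements [n].
    The coefficient of [a ^+ 2] is the weight at 0. *)
Lemma odd_energy (M : rat) : odd d ->
  (forall n : F, P * (etaQ n + q * (n == 0)%:R - 1) <= M) ->
  q ^+ d * (2 * S) <=
    (q ^+ d + q ^+ d.-1 + P * (q - 1)) * a ^+ 2 + M * (q ^+ d * a - a ^+ 2).
Proof.
move=> d_odd PM; have [chi chiP] := exists_additive_char F.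
rewrite -sum_twice_square_indicator.
have -> : q ^+ d + q ^+ d.-1 + P * (q - 1) = odd_weight (0 : 'rV[F]_d).
  by rewrite /odd_weight sqnorm0 !eqxx eta0 /P /q /etaQ /=; ring.
apply: (spectral_bound chiP) => [z|m m0].
  exact: odd_weight_transform.
by rewrite /odd_weight (negPf m0) mul0r add0r PM.
Qed.

Lemma even_energy (M : rat) : (0 < d)%N -> ~~ odd d ->
  (forall n : F, P * (etaQ (-1) * etaQ n + (n == 0)%:R - q^-1) <= M) ->
  q ^+ d * (2 * S) <=
    (q ^+ d + q ^+ d.-1 + P * (1 - q^-1)) * a ^+ 2 + M * (q ^+ d * a - a ^+ 2).
Proof.
move=> d_gt0 d_even PM; have [chi chiP] := exists_additive_char F.
rewrite -sum_twice_square_indicator.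
have -> : q ^+ d + q ^+ d.-1 + P * (1 - q^-1) = even_weight (0 : 'rV[F]_d).
  by rewrite /even_weight sqnorm0 !eqxx eta0 /P /q /etaQ /=; ring.
apply: (spectral_bound chiP) => [z|m m0].
  exact: even_weight_transform.
by rewrite /even_weight (negPf m0) mul0r add0r PM.
Qed.

End Energy.

(** * The sign of [eta (-1)] and the four residue cases *)

Lemma eta_opp1_1mod4 (F : finFieldType) : (#|F| %% 4 = 1)%N -> eta (-1 : F) = 1.
Proof.
move=> q1; rewrite eta_opp1; last by lia.
by rewrite -signr_odd; have -> : odd (#|F|.-1)./2 = false by lia.
Qed.

Lemma eta_opp1_3mod4 (F : finFieldType) : (#|F| %% 4 = 3)%N -> eta (-1 : F) = -1.
Proof.
move=> q3; rewrite eta_opp1; last by lia.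
by rewrite -signr_odd; have -> : odd (#|F|.-1)./2 = true by lia.
Qed.

(** Serves [d] congruent to 0 or 1 mod 4, where [d./2] is even and the sign is positive for both
    residues of q. *)
Lemma eta_opp1_even_power (R : pzRingType) (F : finFieldType) (k : nat) :
  ~~ odd k -> (eta (-1 : F))%:~R ^+ k = 1 :> R.
Proof.
move=> k_even; rewrite -(even_halfK k_even) -mul2n exprM -rmorphXn eta_sqr.
by rewrite oppr_eq0 oner_eq0 expr1n.
Qed.

(* q = #|F| odd; all bounds computed in rat. For odd d, (d-1)/2 = d./2 and
   (d+1)/2 = d./2.+1; for even d, d/2 = d./2 and (d-2)/2 = d./2 - 1. *)
Theorem theorem1p2 (F : finFieldType) (d : nat) (A : {set 'rV[F]_d}) :
  odd #|F| -> (0 < d)%N ->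
  let q : rat := (#|F|)%:R in
  let a : rat := (#|A|)%:R in
  let S : rat := (SQ A + ZR A)%:R in
  [/\ (d %% 4 = 3)%N -> (#|F| %% 4 = 3)%N ->
        S <= a ^+ 2 / 2 + a ^+ 2 / (2 * q) - a ^+ 2 / (2 * q ^+ d./2)
             - a ^+ 2 / (2 * q ^+ d./2.+1) + q ^+ d./2 * a,
      (d %% 4 = 1)%N \/ ((d %% 4 = 3)%N /\ (#|F| %% 4 = 1)%N) ->
        S <= a ^+ 2 / 2 + a ^+ 2 / (2 * q) + q ^+ d./2.+1 * a / 2
             - q ^+ d./2 * a / 2,
      (d %% 4 = 2)%N -> (#|F| %% 4 = 3)%N ->
        S <= a ^+ 2 / 2 + a ^+ 2 / (2 * q) - a ^+ 2 / q ^+ d./2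
             + q ^+ d./2 * a / 2 + q ^+ (d./2 - 1) * a / 2
    & (d %% 4 = 0)%N \/ ((d %% 4 = 2)%N /\ (#|F| %% 4 = 1)%N) ->
        S <= a ^+ 2 / 2 + a ^+ 2 / (2 * q) + q ^+ d./2 * a / 2
             - q ^+ (d./2 - 1) * a / 2].
Proof.
move=> Fodd d_gt0 q a S.
have q1 : 1 < q by rewrite ltr1n card_gt1.
have q0 : q != 0 by rewrite gt_eqF // (lt_trans ltr01).
have Q_gt0 : 0 < q ^+ d./2 by rewrite exprn_gt0 // (lt_trans ltr01).
have Q0 : q ^+ d./2 != 0 by rewrite gt_eqF.
have scale X : q ^+ d * (2 * S) <= q ^+ d * (2 * X) -> S <= X.
  by rewrite !ler_pM2l // exprn_gt0 // (lt_trans ltr01).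
have qV : 0 < q^-1 < 1 by rewrite invr_gt0 invf_lt1 ?(lt_trans ltr01) // q1.
have odd_powers : odd d ->
    (q ^+ d = q * (q ^+ d./2) ^+ 2) * (q ^+ d.-1 = (q ^+ d./2) ^+ 2).
  move=> d_odd; rewrite -exprM muln2 -exprS.
  by split; congr (_ ^+ _); move: d_odd d_gt0; lia.
have even_powers : ~~ odd d ->
    (q ^+ d = (q ^+ d./2) ^+ 2) * (q ^+ d.-1 = (q ^+ d./2) ^+ 2 / q) *
    (q ^+ (d./2 - 1) = q ^+ d./2 / q).
  move=> d_even; rewrite -exprM muln2.
  (* For even positive [d], [d./2] is at least 1, so the truncated subtraction is exact. *)
  have -> : d./2 = (d./2 - 1).+1 by move: d_even d_gt0; lia.
  by rewrite doubleS !exprSr !mulfK // -!exprSr subn1 /=; split; first split;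
    congr (_ ^+ _); move: d_even d_gt0; lia.
have eta_val (n : F) : [\/ n = 0 /\ eta n = 0, (n == 0) = false /\ eta n = 1
    | (n == 0) = false /\ eta n = -1].
  rewrite /eta; case: eqVneq => [->|n0]; first by constructor 1.
  by case: ifP => _; [constructor 2 | constructor 3].
split.
- move=> d3 q3; have d_odd : odd d by lia.
  (* The sign is negative, so the maximum is reached at non-squares: [- q ^+ d./2 * (-1 - 1)]. *)
  have := odd_energy A Fodd (M := 2 * q ^+ d./2) d_odd.
  have -> : ((eta (-1 : F))%:~R * #|F|%:R) ^+ d./2 = - q ^+ d./2.
    rewrite (eta_opp1_3mod4 q3) rmorphN1 exprMn -signr_odd.
    by have -> : odd d./2 = true; [lia | rewrite expr1 mulN1r].
  rewrite -/q -/a -/S => bound; apply: scale; apply: le_trans (bound _) _.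
    move=> n; case: (eta_val n) => -[] n0 ->;
      rewrite ?n0 ?eqxx /=; nra.
  (* With this [M], the claimed bound times [2 * q ^+ d] equals the energy bound. *)
  by rewrite !(odd_powers d_odd) (exprS q d./2) le_eqVlt; apply/predU1P; left;
    field; rewrite ?q0 ?Q0.
- move=> dq; have d_odd : odd d by lia.
  (* The sign is positive, so the maximum is reached at [n = 0]. *)
  have := odd_energy A Fodd (M := q ^+ d./2 * (q - 1)) d_odd.
  have -> : ((eta (-1 : F))%:~R * #|F|%:R) ^+ d./2 = q ^+ d./2.
    case: dq => [d1|[_ q1m4]]; last by rewrite (eta_opp1_1mod4 q1m4) mul1r.
    by rewrite exprMn eta_opp1_even_power ?mul1r //; lia.
  rewrite -/q -/a -/S => bound; apply: scale; apply: le_trans (bound _) _.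
    move=> n; case: (eta_val n) => -[] n0 ->;
      rewrite ?n0 ?eqxx /=; nra.
  by rewrite !(odd_powers d_odd) (exprS q d./2) le_eqVlt; apply/predU1P; left;
    field; rewrite ?q0 ?Q0.
- move=> d2 q3; have d_even : ~~ odd d by lia.
  (* Both the leading sign and [eta (-1)] are negative, so nonzero squares give the maximum. *)
  have := even_energy A Fodd (M := q ^+ d./2 * (1 + q^-1)) d_gt0 d_even.
  have -> : ((eta (-1 : F))%:~R * #|F|%:R) ^+ d./2 = - q ^+ d./2.
    rewrite (eta_opp1_3mod4 q3) rmorphN1 exprMn -signr_odd.
    by have -> : odd d./2 = true; [lia | rewrite expr1 mulN1r].
  rewrite (eta_opp1_3mod4 q3).
  rewrite -/q -/a -/S => bound; apply: scale; apply: le_trans (bound _) _.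
    move=> n; case: (eta_val n) => -[] n0 ->;
      rewrite ?n0 ?eqxx /=; nra.
  by rewrite !(even_powers d_even) le_eqVlt; apply/predU1P; left;
    field; rewrite ?q0 ?Q0.
- move=> dq; have d_even : ~~ odd d by lia.
  (* This is the value at [n = 0], and also wherever [eta (-1) * eta n = 1]. *)
  have := even_energy A Fodd (M := q ^+ d./2 * (1 - q^-1)) d_gt0 d_even.
  have -> : ((eta (-1 : F))%:~R * #|F|%:R) ^+ d./2 = q ^+ d./2.
    case: dq => [d1|[_ q1m4]]; last by rewrite (eta_opp1_1mod4 q1m4) mul1r.
    by rewrite exprMn eta_opp1_even_power ?mul1r //; lia.
  rewrite -/q -/a -/S => bound; apply: scale; apply: le_trans (bound _) _.
    (* The case [d] divisible by 4 leaves [eta (-1)] undetermined, so all its possible values are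
       tried. *)
    move=> n; case: (eta_val (-1)) => -[] _ ->; case: (eta_val n) => -[] n0 ->;
      rewrite ?n0 ?eqxx /=; nra.
  by rewrite !(even_powers d_even) le_eqVlt; apply/predU1P; left;
    field; rewrite ?q0 ?Q0.
Qed.
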